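(* Let $R$ be a ring and let $\sigma$ be a preradical on $R\text{-Mod}$. Then the class $\mathscr{P}_\sigma$ of all fully $\sigma$-co-first modules is a conatural class.
   Context: $R$ is an associative ring with identity; modules are left $R$-modules. A preradical on $R\text{-Mod}$ is a functor $\sigma:R\text{-Mod}\to R\text{-Mod}$ with $\sigma(M)\le M$ for all $M$ and $f(\sigma(M))\le\sigma(N)$ for every homomorphism $f:M\to N$ ($\sigma(f)$ being the restriction of $f$). $\mathbb{T}_\sigma=\{M\mid\sigma(M)=M\}$. $\mathscr{P}_\sigma$ is the class of all modules $M$ having no nonzero quotient in $\mathbb{T}_\sigma$ (the zero module is included). $R\text{-quot}$ is the collection of all classes of modules closed under quotients (homomorphic images). For $\mathscr{D}\in R\text{-quot}$, $\mathscr{D}^{\perp_\twoheadrightarrow}$ is the class of all modules having no nonzero quotient in $\mathscr{D}$; it is the pseudocomplement of $\mathscr{D}$ in $R\text{-quot}$. A conatural class is a class of the form $\mathscr{D}^{\perp_\twoheadrightarrow}$ with $\mathscr{D}\in R\text{-quot}$; $R\text{-conat}$ is the collection of conatural classes. *)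

(* Defs.v *)
From mathcomp Require Import all_boot all_algebra.
From mathcomp Require Import boolp classical_sets.
Set Implicit Arguments.
Unset Strict Implicit.
Unset Printing Implicit Defensive.
Import GRing.Theory.
Local Open Scope classical_set_scope.
Local Open Scope ring_scope.

(* [N] is a quotient of [M] up to isomorphism: by the first isomorphism theorem
   the quotients M / K are exactly the codomains of surjective linear maps. *)
Definition is_quotient (R : pzRingType) (M N : lmodType R) : Prop :=
  exists f : {linear M -> N}, range f = [set: N].

Definition nonzero_module (R : pzRingType) (M : lmodType R) : Prop :=
  exists x : M, x != 0.

(* The functor acts on a linear map f by restriction, so the last field is what
   makes this action well defined; the functor laws are then automatic. *)
Record preradical (R : pzRingType) := Preradical {
  prerad :> forall M : lmodType R, set M;
  prerad_submod : forall M : lmodType R, GRing.submod_closed (mem (@prerad M));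
  prerad_hom : forall (M N : lmodType R) (f : {linear M -> N}),
    f @` (@prerad M) `<=` @prerad N
}.

Arguments prerad {R} _ _.

(* Classes of modules are plain predicates: [set (lmodType R)] would be
   universe-inconsistent. *)
Definition module_class (R : pzRingType) := lmodType R -> Prop.

Definition torsion_class (R : pzRingType) (sigma : preradical R) :
    module_class R :=
  fun M => sigma M = [set: M].

Definition has_nonzero_quotient_in (R : pzRingType) (D : module_class R)
    (M : lmodType R) : Prop :=
  exists N : lmodType R, [/\ is_quotient M N, nonzero_module N & D N].

(* The class P_sigma. *)
Definition fully_cofirst (R : pzRingType) (sigma : preradical R) :
    module_class R :=
  fun M => ~ has_nonzero_quotient_in (torsion_class sigma) M.

(* Membership in R-quot. *)
Definition quotient_closed (R : pzRingType) (D : module_class R) : Prop :=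
  forall M N : lmodType R, D M -> is_quotient M N -> D N.

Definition quot_perp (R : pzRingType) (D : module_class R) : module_class R :=
  fun M => ~ has_nonzero_quotient_in D M.

(* Membership in R-conat; equality of classes is extensional. *)
Definition conatural (R : pzRingType) (C : module_class R) : Prop :=
  exists2 D : module_class R, quotient_closed D
    & forall M : lmodType R, C M <-> quot_perp D M.

(* Main.v *)
Require Import Defs.
From mathcomp Require Import all_boot all_algebra.
From mathcomp Require Import boolp classical_sets.

(** A preradical is functorial, so an epimorphism [f : M -> N] sends
    [sigma M = M] into [sigma N]; its image being [N], this forces
    [sigma N = N]. *)
Lemma torsion_class_quotient_closed (R : pzRingType) (sigma : preradical R) :
  quotient_closed (torsion_class sigma).
Proof.
move=> M N sigmaM [f f_surj]; rewrite /torsion_class.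
rewrite -subTset -f_surj -sigmaM; exact: prerad_hom.
Qed.

(** [P_sigma] is by definition the class of modules without nonzero quotient in
    the torsion class of [sigma], so the torsion class itself is the
    quotient-closed class whose pseudocomplement is [P_sigma]. *)
Theorem corollary4p9 (R : pzRingType) (sigma : preradical R) :
  conatural (fully_cofirst sigma).
Proof.
by exists (torsion_class sigma); first exact: torsion_class_quotient_closed.
Qed.
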